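(* Let $\Omega\subset\mathbb{R}^n_{\ge 0}$ be a bounded nonempty relatively open subset such that $\widehat{\Omega}=\{(x_1,\dots,x_n)\in\mathbb{R}^n \mid (|x_1|,\dots,|x_n|)\in\Omega\}$ is convex in $\mathbb{R}^n$. Then for any normalized symplectic capacity $c$ on $\mathbb{R}^{2n}$ the convex toric domains $X_{\Omega}$ and $X_{\overline{\Omega}}$ satisfy $$c(X_{\Omega})=c(X_{\overline{\Omega}})=\min\Big\{\|v\|_{\Omega}^*\,\Big|\,v=(v_1,\dots,v_n)\in\mathbb{Z}^n_{\ge 0},\ \sum_{i=1}^n v_i=1\Big\}=\min\{\|e_i\|_{\Omega}^*\mid i=1,\dots,n\},$$ where $\{e_i\}_{i=1}^n$ is the standard orthonormal basis of $\mathbb{R}^n$.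
   Context: $\omega_0=\sum_{j=1}^n dx_j\wedge dy_j$ is the standard symplectic structure on $\mathbb{R}^{2n}=\mathbb{C}^n$ (with $z_j=x_j+iy_j$). A symplectic capacity on $\mathbb{R}^{2n}$ is a map $c$ assigning to each subset $U\subset\mathbb{R}^{2n}$ a number $c(U)\in[0,\infty]$ such that: (Monotonicity) $c(U)\le c(V)$ for $U\subset V\subset\mathbb{R}^{2n}$; (Conformality) $c(\psi(U))=|\alpha|c(U)$ for every diffeomorphism $\psi$ of $\mathbb{R}^{2n}$ with $\psi^*\omega_0=\alpha\omega_0$, $\alpha\neq 0$; (Nontriviality) $0<c(B^{2n}(1))$ and $c(Z^{2n}(1))<\infty$. Here $B^{2n}(r)=\{z\in\mathbb{R}^{2n}\mid |z|^2<r^2\}$ and $Z^{2n}(R)=B^2(R)\times\mathbb{R}^{2n-2}$, where the factor $B^2(R)$ is the disc in the $z_1$-plane. It is normalized if $c(B^{2n}(1))=c(Z^{2n}(1))=\pi$. $\mathbb{R}^n_{\ge 0}$ (resp. $\mathbb{Z}^n_{\ge0}$) is the set of $x\in\mathbb{R}^n$ (resp. $\mathbb{Z}^n$) with all $x_i\ge 0$; $\mu:\mathbb{C}^n\to\mathbb{R}^n$, $\mu(z_1,\dots,z_n)=(\pi|z_1|^2,\dots,\pi|z_n|^2)$; $X_\Omega=\mu^{-1}(\Omega)$ and $X_{\overline\Omega}=\mu^{-1}(\overline\Omega)$, with $\overline\Omega$ the closure of $\Omega$. When $\Omega$ is bounded and $\widehat\Omega$ is convex, these are called convex toric domains. For $v\in\mathbb{R}^n_{\ge0}$,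 $\|v\|_\Omega^*=\sup\{\langle v,w\rangle\mid w\in\Omega\}$ with $\langle\cdot,\cdot\rangle$ the Euclidean inner product. *)

(* Defs.v *)
From mathcomp Require Import all_boot all_order all_algebra.
From mathcomp Require Import all_classical all_reals all_analysis.

Set Implicit Arguments.
Unset Strict Implicit.
Unset Printing Implicit Defensive.

Import Order.TTheory GRing.Theory Num.Theory.
Import numFieldNormedType.Exports.

Local Open Scope classical_set_scope.
Local Open Scope ring_scope.

(* R^{2n} = C^n: the pair (x, y) stands for z with z_j = x_j + i y_j.
   The library norm on this type is a maximum norm: it is only used for the
   topology and for differentiability, the Euclidean norm being [sqnorm]. *)
Notation R2n R n := ('rV[R]_n * 'rV[R]_n)%type.

Section SymplecticCapacities.
Context {R : realType}.

(* Meant for finite-dimensional V, where x |-> 'd f x is of class C^k as soon as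
   x |-> 'd f x v is for each vector v. *)
Fixpoint of_class_C {V W : normedModType R} (k : nat) (f : V -> W) : Prop :=
  if k is k'.+1 then
    (forall x, differentiable f x) /\
    (forall v, of_class_C k' (fun x => 'd f x v))
  else continuous f.

Definition smooth {V W : normedModType R} (f : V -> W) : Prop :=
  forall k, of_class_C k f.

Definition diffeomorphism {V W : normedModType R} (f : V -> W) : Prop :=
  smooth f /\ exists g : W -> V, [/\ cancel f g, cancel g f & smooth g].

(* omega_0 = \sum_j dx_j /\ dy_j. *)
Definition omega0 {n : nat} (u v : R2n R n) : R :=
  \sum_(j < n) (u.1 0 j * v.2 0 j - u.2 0 j * v.1 0 j).

(* psi^* omega_0 = alpha omega_0. *)
Definition conformally_symplectic {n : nat} (alpha : R)
    (psi : R2n R n -> R2n R n) : Prop :=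
  forall x u v, omega0 ('d psi x u) ('d psi x v) = alpha * omega0 u v.

Definition sqnorm {n : nat} (z : R2n R n) : R :=
  \sum_(j < n) (z.1 0 j ^+ 2 + z.2 0 j ^+ 2).

Definition B2n {n : nat} (r : R) : set (R2n R n) :=
  [set z | sqnorm z < r ^+ 2].

(* The complex dimension is n.+1, so that the coordinate z_1 exists. *)
Definition Z2n {n : nat} (r : R) : set (R2n R n.+1) :=
  [set z : R2n R n.+1 | z.1 0 ord0 ^+ 2 + z.2 0 ord0 ^+ 2 < r ^+ 2].

Record symplectic_capacity {n : nat} (c : set (R2n R n.+1) -> \bar R) : Prop :=
  SymplecticCapacity {
    capacity_ge0 : forall U, (0 <= c U)%E;
    capacity_monotone : forall U V, U `<=` V -> (c U <= c V)%E;
    capacity_conformal : forall (alpha : R) (psi : R2n R n.+1 -> R2n R n.+1),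
      alpha != 0 -> diffeomorphism psi -> conformally_symplectic alpha psi ->
      forall U, c (psi @` U) = (`|alpha|%:E * c U)%E;
    capacity_ball_gt0 : (0 < c (B2n 1))%E;
    capacity_cylinder_lty : (c (Z2n 1) < +oo)%E }.

Definition normalized_capacity {n : nat}
    (c : set (R2n R n.+1) -> \bar R) : Prop :=
  [/\ symplectic_capacity c,
      c (B2n 1) = (@pi R)%:E & c (Z2n 1) = (@pi R)%:E].

End SymplecticCapacities.

Section ToricDomains.
Context {R : realType} {n : nat}.

Definition nonneg_orthant : set 'rV[R]_n := [set x | forall i, 0 <= x 0 i].

Definition relatively_open (A Omega : set 'rV[R]_n) : Prop :=
  exists2 U, open U & Omega = U `&` A.

Definition hat (Omega : set 'rV[R]_n) : set 'rV[R]_n :=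
  [set x | Omega (map_mx Num.norm x)].

Definition mu (z : R2n R n) : 'rV[R]_n :=
  \row_j (pi * (z.1 0 j ^+ 2 + z.2 0 j ^+ 2)).

Definition toric_domain (Omega : set 'rV[R]_n) : set (R2n R n) :=
  mu @^-1` Omega.

Definition inner (v w : 'rV[R]_n) : R := \sum_(i < n) v 0 i * w 0 i.

Definition dual_norm (Omega : set 'rV[R]_n) (v : 'rV[R]_n) : \bar R :=
  ereal_sup [set (inner v w)%:E | w in Omega].

End ToricDomains.

Definition is_min {R : realType} (A : set (\bar R)) (m : \bar R) : Prop :=
  A m /\ lbound A m.

(* Main.v *)
Require Import Defs.
From HB Require Import structures.
From mathcomp Require Import all_boot all_order all_algebra all_fingroup.
From mathcomp Require Import all_classical all_reals all_analysis.
From mathcomp Require Import zify ring lra.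

Set Implicit Arguments.
Unset Strict Implicit.
Unset Printing Implicit Defensive.

Import Order.TTheory GRing.Theory Num.Theory.
Import numFieldNormedType.Exports.

Local Open Scope classical_set_scope.
Local Open Scope ring_scope.

(** For [Omega] in the orthant, [||e_i||*] is the supremum of the i-th coordinate
    on [Omega], so the domain X_Omega, and also X_(closure Omega), lies in the
    cylinder pi |z_i|^2 <= ||e_i||*, whose capacity is at most [||e_i||*]
    ([capacity_toric_closure_le]).  Conversely, let [r] be smaller than every
    [||e_i||*].  Since [hat Omega] is convex and invariant under changes of signs,
    it contains with each point its projections on the coordinate axes, hence it
    contains the simplex with vertices 0 and r e_1, ..., r e_n ([simplex_sub]).
    The preimage under [mu] of that simplex is a ball of capacity [r], so the
    capacity of X_Omega is at least [r] ([capacity_toric_ge]).  Both bounds meet at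
    the smallest [||e_i||*], and monotonicity gives the same value for the
    closure.

    The capacities of balls and cylinders of arbitrary size, and of cylinders over
    other coordinates than z_1, follow from conformality applied to linear maps:
    homotheties composed with permutations of the z_j ([scale_perm]).  These count
    as smooth because all directional derivatives of a continuous linear map are
    constant ([linear_smooth]).

    The two minima run over the same vectors: nonnegative integers with sum 1 are
    one 1 and zeros elsewhere ([int_simplex_vertex]). *)

(** * Continuous linear maps are smooth *)

Section LinearMapsAreSmooth.
Context {R : realType}.

Lemma of_class_C_cst (V W : normedModType R) (k : nat) (w : W) :
  of_class_C k (fun _ : V => w).
Proof.
elim: k w => [|k IHk] w /=; first exact: cst_continuous.
split=> [x|v]; first exact: differentiable_cst.
suff -> : (fun x : V => 'd (fun=> w) x v) = (fun=> 0) by exact: IHk.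
by apply/funext => x; rewrite (diff_cst w).
Qed.

(** The differential of [f] is [f] at every point, so each directional
    derivative is constant. *)
Lemma linear_smooth (V W : normedModType R) (f : {linear V -> W}) :
  continuous f -> smooth f.
Proof.
move=> cf [//|k]; split=> [x|v]; first exact: linear_differentiable.
suff -> : (fun x => 'd f x v) = (fun=> f v) by exact: of_class_C_cst.
by apply/funext => x; rewrite (diff_lin x cf).
Qed.

End LinearMapsAreSmooth.

(** * Homotheties composed with permutations of the complex coordinates *)

Section PermutedHomotheties.
Context {R : realType} {n : nat}.
Implicit Types (r : R) (s : 'S_n) (z : R2n R n).

Definition scale_perm r s z : R2n R n :=
  (r *: col_perm s z.1, r *: col_perm s z.2).

Lemma scale_perm_is_linear r s : linear (scale_perm r s).
Proof.
by move=> a u v; congr (_, _); apply/rowP => j; rewrite !mxE /=; ring.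
Qed.

HB.instance Definition _ r s :=
  GRing.isLinear.Build R (R2n R n) (R2n R n) *:%R (scale_perm r s)
    (scale_perm_is_linear r s).

Lemma col_perm_continuous s : continuous (@col_perm R 1 n s).
Proof.
move=> x A [P Px PA]; exists (fun i j => P i (s^-1%g j)) => [i j|y Py].
  by have := Px i (s^-1%g j); rewrite mxE permKV.
by apply: PA => i j; have := Py i (s j); rewrite permK mxE.
Qed.

Lemma scale_perm_continuous r s : continuous (scale_perm r s).
Proof.
have half : continuous (fun u => r *: @col_perm R 1 n s u).
  move=> u; have cu : {for u, continuous (@col_perm R 1 n s)}.
    exact: col_perm_continuous.
  exact: (continuous_comp cu (@scaler_continuous R 'rV[R]_n r _)).
move=> [u v]; apply: (@cvg_pair _ _ _ _ (nbhs (r *: col_perm s u))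
  (nbhs (r *: col_perm s v))).
- exact: (cvg_comp fst (fun u => r *: col_perm s u) cvg_fst (half u)).
- exact: (cvg_comp snd (fun v => r *: col_perm s v) cvg_snd (half v)).
Qed.

Lemma scale_permK r s :
  r != 0 -> cancel (scale_perm r s) (scale_perm r^-1 s^-1%g).
Proof.
move=> r0 [u v]; congr (_, _); apply/rowP => j;
  by rewrite !mxE permKV mulKf.
Qed.

Lemma scale_permVK r s :
  r != 0 -> cancel (scale_perm r^-1 s^-1%g) (scale_perm r s).
Proof.
move=> r0 [u v]; congr (_, _); apply/rowP => j;
  by rewrite !mxE permK mulVKf.
Qed.

Lemma scale_perm_diffeomorphism r s :
  r != 0 -> diffeomorphism (scale_perm r s).
Proof.
move=> r0; split; first by apply: linear_smooth; exact: scale_perm_continuous.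
exists (scale_perm r^-1 s^-1%g); split; [exact: scale_permK|exact: scale_permVK|].
by apply: linear_smooth; exact: scale_perm_continuous.
Qed.

(** Permuting the pairs (x_j, y_j) only reindexes the sum [omega0], which is
    quadratic in the scale. *)
Lemma scale_perm_conformal r s :
  conformally_symplectic (r ^+ 2) (scale_perm r s).
Proof.
move=> x u v; rewrite (diff_lin x (@scale_perm_continuous r s)) /omega0.
rewrite mulr_sumr [RHS](reindex_inj (@perm_inj _ s)) /=.
by apply: eq_bigr => j _; rewrite !mxE; ring.
Qed.

Lemma sqnorm_scale r z : sqnorm (scale_perm r 1%g z) = r ^+ 2 * sqnorm z.
Proof.
rewrite /sqnorm mulr_sumr; apply: eq_bigr => j _.
by rewrite !mxE perm1; ring.
Qed.

End PermutedHomotheties.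

(** * Comparison of a capacity with balls and cylinders *)

Section CapacityBounds.
Context {R : realType} {n : nat} (c : set (R2n R n.+1) -> \bar R)
  (c_normalized : normalized_capacity c).

Lemma capacity_scale_perm (r : R) (s : 'S_n.+1) (U : set (R2n R n.+1)) :
  r != 0 -> c (scale_perm r s @` U) = ((r ^+ 2)%:E * c U)%E.
Proof.
move=> r0; case: c_normalized => -[_ _ conf _ _] _ _.
rewrite (conf (r ^+ 2)) ?expf_neq0 ?ger0_norm ?sqr_ge0 //.
- exact: scale_perm_diffeomorphism.
- exact: scale_perm_conformal.
Qed.

Lemma sqr_radius (a : R) : 0 < a -> Num.sqrt (a / pi) ^+ 2 = a / pi.
Proof. by move=> a0; rewrite sqr_sqrtr // ltW // divr_gt0 // pi_gt0. Qed.

Lemma radius_neq0 (a : R) : 0 < a -> Num.sqrt (a / pi) != 0.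
Proof. by move=> a0; rewrite gt_eqF // sqrtr_gt0 divr_gt0 // pi_gt0. Qed.

Lemma capacity_scale_perm_pi (a : R) (s : 'S_n.+1) (U : set (R2n R n.+1)) :
  0 < a -> c U = (@pi R)%:E -> c (scale_perm (Num.sqrt (a / pi)) s @` U) = a%:E.
Proof.
move=> a0 cU; rewrite capacity_scale_perm ?radius_neq0 // cU -EFinM sqr_radius //.
by rewrite divfK // gt_eqF // pi_gt0.
Qed.

Lemma capacity_ge_ball (a : R) (U : set (R2n R n.+1)) :
  0 < a -> [set z | pi * sqnorm z < a] `<=` U -> (a%:E <= c U)%E.
Proof.
move=> a0 ballU; case: (c_normalized) => -[_ mono _ _ _] cB _.
rewrite -(capacity_scale_perm_pi 1%g a0 cB).
apply: mono => _ [z zB <-]; apply: ballU => /=.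
rewrite sqnorm_scale sqr_radius // mulrA [pi * _]mulrC divfK ?gt_eqF ?pi_gt0 //.
by move: zB; rewrite /B2n /= expr1n -[X in _ -> _ < X]mulr1 ltr_pM2l.
Qed.

(** Normalization speaks of the z_1-cylinder only; the transposition of
    coordinates 1 and i carries it to the z_i-cylinder. *)
Lemma capacity_le_cylinder (a : R) (i : 'I_n.+1) (U : set (R2n R n.+1)) :
  0 < a ->
  U `<=` [set z : R2n R n.+1 | pi * (z.1 0 i ^+ 2 + z.2 0 i ^+ 2) < a] ->
  (c U <= a%:E)%E.
Proof.
move=> a0 Ucyl; case: (c_normalized) => -[_ mono _ _ _] _ cZ.
rewrite -(capacity_scale_perm_pi (tperm ord0 i) a0 cZ).
apply: mono => z /Ucyl /= za; set r := Num.sqrt _.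
exists (scale_perm r^-1 (tperm ord0 i)^-1%g z); last first.
  by apply: scale_permVK; exact: radius_neq0.
rewrite /Z2n /= !mxE tpermV tpermL !exprMn exprVn sqr_radius // -mulrDr.
rewrite invf_div expr1n.
by rewrite -mulrA mulrCA ltr_pdivrMl // mulr1.
Qed.

End CapacityBounds.

(** * Unconditional convex sets contain simplices *)

Section UnconditionalConvexity.
Context {R : realType} {n : nat}.
Implicit Types (x y w : 'rV[R]_n) (Omega : set 'rV[R]_n).

Lemma convex_setP (V : lmodType R) (A : set V) (t : R) (x y : V) :
  convex_set A -> 0 <= t -> t <= 1 -> A x -> A y ->
  A (t *: x + (1 - t) *: y).
Proof.
move=> cA t0 t1 Ax Ay.
by have := cA x y (Itv01 t0 t1); rewrite !inE; exact.
Qed.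

Lemma convex_set_midpoint (V : lmodType R) (A : set V) (x y : V) :
  convex_set A -> A x -> A y -> A (2^-1 *: (x + y)).
Proof.
move=> cA Ax Ay; have -> : 2^-1 *: (x + y) = 2^-1 *: x + (1 - 2^-1) *: y.
  by rewrite scalerDr; congr (_ + _ *: _); field.
by apply: convex_setP => //; rewrite ?invr_ge0 // invf_le1 // ler1n.
Qed.

(** A weighted sum with total weight L lies in L A, not necessarily in A:
    leaving L free lets the induction proceed without renormalising. *)
Lemma convex_combination (V : lmodType R) (A : set V) (I : Type)
    (p : I -> V) (l : I -> R) (s : seq I) :
  convex_set A -> A !=set0 -> (forall i, A (p i)) -> (forall i, 0 <= l i) ->
  exists2 q, A q & \sum_(i <- s) l i *: p i = (\sum_(i <- s) l i) *: q.
Proof.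
move=> cA [a Aa] Ap l0; elim: s => [|i s [q Aq IHs]].
  by exists a; rewrite ?big_nil ?scale0r.
rewrite !big_cons IHs; set L := \sum_(j <- s) l j.
have L0 : 0 <= L by exact: sumr_ge0.
have [S0|S0] := eqVneq (l i + L) 0.
  move/eqP: (S0); rewrite paddr_eq0 // => /andP[/eqP -> /eqP ->].
  by exists a; rewrite // !scale0r !addr0 scale0r.
have Sgt0 : 0 < l i + L by rewrite lt_def S0 addr_ge0.
exists ((l i / (l i + L)) *: p i + (1 - l i / (l i + L)) *: q).
  apply: convex_setP => //; first by rewrite divr_ge0 // ltW.
  by rewrite ler_pdivrMr // mul1r lerDl.
rewrite scalerDr !scalerA mulrC divfK //; congr (_ + _ *: _).
by field.
Qed.

Lemma hat_ge0 Omega x : (forall i, 0 <= x 0 i) -> hat Omega x = Omega x.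
Proof.
move=> x0; rewrite /hat /=; congr Omega.
by apply/rowP => i; rewrite mxE ger0_norm.
Qed.

(** The set [hat Omega] is stable under sign changes: flipping every coordinate
    of [w] but the [i]-th and taking the midpoint with [w] leaves only the
    [i]-th coordinate. *)
Lemma hat_axis_projection Omega w i :
  Omega `<=` nonneg_orthant -> convex_set (hat Omega) ->
  Omega w -> hat Omega (w 0 i *: delta_mx 0 i).
Proof.
move=> Opos cO Ow; have w0 := Opos _ Ow.
pose w' := \row_j (if j == i then w 0 j else - w 0 j).
have Ow' : hat Omega w'.
  rewrite /hat /=; suff -> : map_mx Num.norm w' = w by [].
  by apply/rowP => j; rewrite !mxE; case: ifP => _; rewrite ?normrN ger0_norm.
have := convex_set_midpoint cO (_ : hat Omega w) Ow'.
rewrite hat_ge0 // => /(_ Ow); congr hat; apply/rowP => j.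
rewrite !mxE eqxx /= eq_sym.
by case: eqP => [->|_] /=; field.
Qed.

Lemma hat0 Omega :
  Omega `<=` nonneg_orthant -> convex_set (hat Omega) -> Omega !=set0 ->
  hat Omega 0.
Proof.
move=> Opos cO [w Ow]; have w0 := Opos _ Ow.
have hw : hat Omega w by rewrite hat_ge0.
have hNw : hat Omega (- w).
  rewrite /hat /=; suff -> : map_mx Num.norm (- w) = w by [].
  by apply/rowP => j; rewrite !mxE normrN ger0_norm.
by have := convex_set_midpoint cO hw hNw; rewrite subrr scaler0.
Qed.

Lemma inner_delta i w : inner (delta_mx 0 i) w = w 0 i.
Proof.
rewrite /inner (bigD1 i) //= mxE !eqxx mul1r big1 ?addr0 // => j ji.
by rewrite mxE (negbTE ji) andbF mul0r.
Qed.

(** Each axis carries a point [w_i e_i] of [hat Omega] with [w_i > r], and [x] is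
    a combination of these points and of 0 with the weight [x_i / w_i] on the
    former; these weights add up to at most [(\sum_i x_i) / r <= 1]. *)
Lemma simplex_sub Omega (r : R) x :
  Omega `<=` nonneg_orthant -> convex_set (hat Omega) -> Omega !=set0 ->
  0 < r -> (forall i, (r%:E < dual_norm Omega (delta_mx 0%R i))%E) ->
  (forall i, 0 <= x 0 i) -> \sum_i x 0 i <= r -> Omega x.
Proof.
move=> Opos cO O0 r0 rlt x0 xr.
have /choice [w Hw] : forall i, exists w, Omega w /\ r < w 0 i.
  move=> i; have /ereal_sup_gt [_ [w Ow <-]] := rlt i.
  by rewrite inner_delta lte_fin => rw; exists w.
have wpos i : 0 < w i 0 i by exact: lt_trans (Hw i).2.
pose l i := x 0 i / w i 0 i.
have l0 i : 0 <= l i by rewrite divr_ge0 // ltW.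
have hO : hat Omega !=set0 by exists 0; exact: hat0.
have hp i : hat Omega (w i 0 i *: delta_mx 0 i).
  by apply: hat_axis_projection => //; exact: (Hw i).1.
have [q hq eq_q] := convex_combination (index_enum 'I_n) cO hO hp l0.
have L1 : \sum_i l i <= 1.
  rewrite -(@ler_pM2r _ r) // mul1r (le_trans _ xr) // mulr_suml.
  apply: ler_sum => i _; rewrite /l mulrAC ler_pdivrMr //.
  by rewrite ler_wpM2l // ltW // (Hw i).2.
have -> : Omega x = hat Omega x by rewrite hat_ge0.
have L0 : 0 <= \sum_i l i by exact: sumr_ge0.
have := convex_setP cO L0 L1 hq (hat0 Opos cO O0).
rewrite scaler0 addr0 -eq_q; congr hat; apply/rowP => j.
rewrite summxE (bigD1 j) //= !mxE !eqxx mulr1 divfK ?gt_eqF //.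
rewrite big1 ?addr0 // => i ij.
by rewrite !mxE (eq_sym j) (negbTE ij) andbF !mulr0.
Qed.

End UnconditionalConvexity.

(** * The capacity of a convex toric domain *)

Lemma int_simplex_vertex (n : nat) (v : 'rV[int]_n) :
  (forall i, 0 <= v 0 i) -> \sum_i v 0 i = 1 -> exists i, v = delta_mx 0 i.
Proof.
move=> v0 v1; have [[i vi]|vz] := pselect (exists i, v 0 i != 0); last first.
  move/eqP: v1; rewrite big1 // => i _.
  by apply/eqP/negPn/negP => vi; apply: vz; exists i.
exists i; have vi1 : 1 <= v 0 i by rewrite -gtz0_ge1 lt_def vi v0.
move: v1; rewrite (bigD1 i) //=; set S := \sum_(j < n | _) _ => v1.
have S0 : 0 <= S by exact: sumr_ge0.
have S0' : S = 0 by lia.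
apply/rowP => j; rewrite mxE eqxx /=; have [->|ji] := eqVneq j i; first by lia.
by apply/eqP; move/eqP: S0'; rewrite psumr_eq0 // => /allP /(_ j);
  rewrite mem_index_enum ji => /(_ isT).
Qed.

Section CapacityOfToricDomain.
Context {R : realType} {n : nat} (Omega : set 'rV[R]_n.+1).
Context (Omega_pos : Omega `<=` nonneg_orthant) (Omega_nonempty : Omega !=set0).
Context (c : set (R2n R n.+1) -> \bar R) (c_normalized : normalized_capacity c).

(** The half-space [x_i <= ||e_i||*] is closed, hence contains [closure Omega];
    its toric domain lies in open z_i-cylinders of capacity arbitrarily close to
    [||e_i||*]. *)
Lemma capacity_toric_closure_le i :
  (c (toric_domain (closure Omega)) <= dual_norm Omega (delta_mx 0%R i))%E.
Proof.
have coord_le w : Omega w -> ((w 0 i)%:E <= dual_norm Omega (delta_mx 0%R i))%E.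
  by move=> Ow; apply: ereal_sup_ubound; exists w; rewrite ?inner_delta.
have [w Ow] := Omega_nonempty.
have := coord_le _ Ow; have := Omega_pos Ow i.
case: (dual_norm _ _) coord_le => [a| |] coord_le wi0 wia; last 2 first.
- by rewrite leey.
- by move: wia; rewrite leNgt ltNyr.
move: wia; rewrite lee_fin => wia; apply/lee_addgt0Pr => e e0.
have ae0 : 0 < a + e by rewrite ltr_wpDl // (le_trans wi0).
rewrite -EFinD; apply: (capacity_le_cylinder c_normalized (i := i)) => // z.
rewrite /toric_domain /= => /(@closureS _ _ [set x : 'rV_n.+1 | x 0 i <= a]).
have closed_a : closed [set x : 'rV[R]_n.+1 | x 0 i <= a].
  have /continuous_closedP := @coord_continuous R 1 n.+1 0 i.
  by move=> /(_ _ (@closed_le R a)).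
rewrite -(closure_id _).1 // => /(_ _)/=; rewrite mxE => za.
by rewrite (le_lt_trans (za _)) ?ltrDl // => x /coord_le; rewrite lee_fin.
Qed.

(** The moment map sends the ball of capacity [r] into the simplex
    [\sum_i x_i < r] of the orthant. *)
Lemma capacity_toric_ge (r : R) :
  convex_set (hat Omega) -> 0 < r ->
  (forall i, (r%:E < dual_norm Omega (delta_mx 0%R i))%E) ->
  (r%:E <= c (toric_domain Omega))%E.
Proof.
move=> cO r0 rlt; apply: (capacity_ge_ball c_normalized) => // z /= zr.
apply: (simplex_sub _ _ _ r0) => //= [i|].
  by rewrite mxE mulr_ge0 ?pi_ge0 // addr_ge0 // sqr_ge0.
apply: le_trans (ltW zr); rewrite /sqnorm mulr_sumr.
by apply: ler_sum => i _; rewrite mxE.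
Qed.

(** Below [||e_i0||*] every ball fits inside, so a strict gap would leave room for
    a ball whose capacity is too large. *)
Lemma capacity_toric_lower_bound i0 :
  convex_set (hat Omega) ->
  (forall i,
    dual_norm Omega (delta_mx 0%R i0) <= dual_norm Omega (delta_mx 0%R i))%E ->
  (dual_norm Omega (delta_mx 0%R i0) <= c (toric_domain Omega))%E.
Proof.
move=> cO i0_min; rewrite leNgt; apply/negP => lt_c.
have c0 : (0 <= c (toric_domain Omega))%E.
  by case: c_normalized => /capacity_ge0.
have [r cr ri] : exists2 r, (c (toric_domain Omega) < r%:E)%E &
    (r%:E < dual_norm Omega (delta_mx 0%R i0))%E.
  move: c0 lt_c; case: (c _) => [x| |] //; last by move=> _; rewrite ltNge leey.
  case: (dual_norm _ _) => [a| |] // _ xa.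
    move: xa; rewrite lte_fin => xa.
    by exists ((x + a) / 2); rewrite lte_fin; lra.
  by exists (x + 1); rewrite ?ltry // lte_fin ltrDl.
have r0 : 0 < r by rewrite -lte_fin (le_lt_trans c0).
have := capacity_toric_ge cO r0 (fun i => lt_le_trans ri (i0_min i)).
by rewrite leNgt cr.
Qed.

End CapacityOfToricDomain.

Theorem theorem1p4 (R : realType) (n : nat) (Omega : set 'rV[R]_n.+1)
    (Omega_bounded : bounded_set Omega)
    (Omega_nonempty : Omega !=set0)
    (Omega_open : relatively_open nonneg_orthant Omega)
    (hat_convex : convex_set (hat Omega))
    (c : set (R2n R n.+1) -> \bar R)
    (c_normalized : normalized_capacity c) :
  [/\ c (toric_domain Omega) = c (toric_domain (closure Omega)),
      is_min [set dual_norm Omega (map_mx intr v) | v in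
                [set v : 'rV[int]_n.+1 |
                  (forall i, 0 <= v 0 i) /\ \sum_i v 0 i = 1]]
        (c (toric_domain Omega)) &
      is_min [set dual_norm Omega (delta_mx 0 i) | i in [set: 'I_n.+1]]
        (c (toric_domain Omega))].
Proof.
have Omega_pos : Omega `<=` nonneg_orthant.
  by case: Omega_open => U _ -> x [].
have c_mono : (c (toric_domain Omega) <= c (toric_domain (closure Omega)))%E.
  case: (c_normalized) => -[_ mono _ _ _] _ _.
  by apply: mono => z Oz; exact: (@subset_closure _ Omega _ Oz).
have c_le := capacity_toric_closure_le Omega_pos Omega_nonempty c_normalized.
pose i0 := [arg min_(i < ord0 : 'I_n.+1) dual_norm Omega (delta_mx 0%R i)]%O.
have i0_min i :
    (dual_norm Omega (delta_mx 0%R i0) <= dual_norm Omega (delta_mx 0%R i))%E.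
  by rewrite /i0; case: arg_minP => // j _; exact.
have c_ge := capacity_toric_lower_bound Omega_pos Omega_nonempty c_normalized
  hat_convex i0_min.
have cE : c (toric_domain Omega) = dual_norm Omega (delta_mx 0%R i0).
  by apply/eqP; rewrite eq_le c_ge (le_trans c_mono).
split.
- apply/eqP; rewrite eq_le c_mono cE /=; exact: c_le.
- split.
    exists (delta_mx 0 i0); last by rewrite map_delta_mx cE.
    split=> [i|]; first by rewrite mxE; case: (_ && _).
    rewrite (bigD1 i0) //= mxE !eqxx big1 ?addr0 // => j ji.
    by rewrite mxE (negbTE ji) andbF.
  move=> _ [v [v0 v1] <-]; have [i ->] := int_simplex_vertex v0 v1.
  by rewrite map_delta_mx cE.
- split; first by exists i0.
  by move=> _ [i _ <-]; rewrite cE.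
Qed.
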